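(* Let $p\in\mathbb{R}$. The inequality $N(a,b)<A_p(a,b)$ holds for all $a,b>0$ with $a\neq b$ if and only if $p\geq 4/3$. Moreover, for all $a,b>0$ with $a\neq b$, $$\alpha_1 A_{4/3}(a,b)<N(a,b)<\beta_1 A_{4/3}(a,b),$$ where $\alpha_1=\dfrac{1}{\sqrt[4]{2}\,\ln(\sqrt{2}+1)}=0.95407\ldots$ and $\beta_1=1$ are the best possible constants (i.e. $\alpha_1$ cannot be replaced by a larger constant and $\beta_1$ cannot be replaced by a smaller constant so that the respective inequality holds for all $a,b>0$ with $a\ne b$).
   Context: For $a,b>0$ with $a\neq b$, the Neuman–Sándor mean is $$N(a,b)=\frac{a-b}{2\,\mathrm{arcsinh}\frac{a-b}{a+b}}=\frac{a-b}{2\ln\frac{a-b+\sqrt{2(a^2+b^2)}}{a+b}}.$$ The power mean of order $r\in\mathbb{R}$ is $A_r(a,b)=\left(\frac{a^r+b^r}{2}\right)^{1/r}$ if $r\neq 0$, and $A_0(a,b)=\sqrt{ab}$. *)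

(* Defs.v *)
From Stdlib Require Import Reals Lra.
Open Scope R_scope.

Definition neuman_sandor_mean (a b : R) : R :=
  (a - b) / (2 * arcsinh ((a - b) / (a + b))).

Definition power_mean (r a b : R) : R :=
  if Req_EM_T r 0 then sqrt (a * b)
  else Rpower ((Rpower a r + Rpower b r) / 2) (1 / r).

Definition alpha1 : R := 1 / (Rpower 2 (1 / 4) * ln (sqrt 2 + 1)).

Definition beta1 : R := 1.

Lemma neuman_sandor_mean_ln (a b : R) (ha : 0 < a) (hb : 0 < b) :
  neuman_sandor_mean a b =
  (a - b) / (2 * ln ((a - b + sqrt (2 * (a ^ 2 + b ^ 2))) / (a + b))).
Proof.
  unfold neuman_sandor_mean, arcsinh.
  assert (E : sqrt (((a - b) / (a + b)) ^ 2 + 1)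
              = sqrt (2 * (a ^ 2 + b ^ 2)) / (a + b)).
  { rewrite <- (sqrt_pow2 (a + b)) at 2 by lra.
    rewrite <- sqrt_div; [ | nra | nra].
    f_equal; field; lra. }
  rewrite E.
  do 3 f_equal; field; lra.
Qed.

(* Main.v *)
Require Import Defs.
From Stdlib Require Import Reals Lra.
From Coquelicot Require Import Coquelicot.
Open Scope R_scope.

(** Put [y = (b/a)^(1/3)] with [b < a]. Then [N(a,b) / A_{4/3}(a,b) = G(y) / f(y)]
    where [f(y) = arcsinh ((1 - y^3) / (1 + y^3))] and
    [G(y) = 2^(-1/4) (1 - y^3) (1 + y^4)^(-3/4)] both vanish at [y = 1]. The
    quotient [f' / G'] is strictly decreasing on [[0, 1]] with value [1] at
    [y = 1], so by Cauchy's mean value theorem [f / G] lies strictly between its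
    limit [1] at [y = 1] and its value [1 / alpha1] at [y = 0]; both ends are
    approached, so the constants are sharp. The bound by [A_p] extends to
    [p >= 4/3] by monotonicity of power means; for [p < 4/3] it fails at
    [(1 + t, 1 - t)] for small [t], where [N = 1 + t^2/6 + o(t^2)] and
    [A_p = 1 + (p-1) t^2/2 + o(t^2)]. *)

(** * Calculus and real powers *)

Lemma cauchy_mean_value (f g f' g' : R -> R) (a b : R) :
  a < b ->
  (forall x, a <= x <= b -> is_derive f x (f' x)) ->
  (forall x, a <= x <= b -> is_derive g x (g' x)) ->
  exists c, a < c < b /\ (f b - f a) * g' c = (g b - g a) * f' c.
Proof.
  intros hab hf hg.
  destruct (MVT_cor2 (fun x => (f b - f a) * g x - (g b - g a) * f x)
              (fun x => (f b - f a) * g' x - (g b - g a) * f' x) a b hab)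
    as [c [E hc]].
  - intros x hx; apply is_derive_Reals.
    apply (is_derive_minus (fun x => (f b - f a) * g x)
             (fun x => (g b - g a) * f x)); apply is_derive_scal; auto.
  - exists c; split; [exact hc | nra].
Qed.

Lemma le_of_derive_le (f g f' g' : R -> R) (a b : R) :
  a <= b -> f a <= g a ->
  (forall x, a <= x <= b -> is_derive f x (f' x)) ->
  (forall x, a <= x <= b -> is_derive g x (g' x)) ->
  (forall x, a <= x <= b -> f' x <= g' x) ->
  f b <= g b.
Proof.
  intros hab h0 hf hg hle.
  destruct (Req_dec a b) as [<- | hne]; [exact h0 | ].
  destruct (MVT_cor2 (fun x => g x - f x) (fun x => g' x - f' x) a b)
    as [c [E hc]]; [lra | | ].
  - intros x hx; apply is_derive_Reals.
    apply (is_derive_minus g f); auto.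
  - specialize (hle c ltac:(lra)); nra.
Qed.

Lemma is_derive_arcsinh (x : R) : is_derive arcsinh x (/ sqrt (x ^ 2 + 1)).
Proof. apply is_derive_Reals, derivable_pt_lim_arcsinh. Qed.

Lemma arcsinh_opp (x : R) : arcsinh (- x) = - arcsinh x.
Proof.
  rewrite <- (sinh_arcsinh x) at 1.
  replace (- sinh (arcsinh x)) with (sinh (- arcsinh x)).
  - apply arcsinh_sinh.
  - unfold sinh; rewrite Ropp_involutive; field.
Qed.

(** This is tanh x <= x without the quotient: the derivatives of the two sides differ by x sinh x >=
    0. *)
Lemma sinh_le_mul_cosh (x : R) : 0 <= x -> sinh x <= x * cosh x.
Proof.
  intros hx.
  apply (le_of_derive_le sinh (fun x => x * cosh x) cosh
           (fun x => cosh x + x * sinh x) 0 x hx).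
  - rewrite sinh_0; lra.
  - intros t _; apply is_derive_Reals, derivable_pt_lim_sinh.
  - intros t _; apply is_derive_Reals.
    replace (cosh t + t * sinh t) with (1 * cosh t + t * sinh t) by ring.
    apply derivable_pt_lim_mult;
      [apply derivable_pt_lim_id | apply derivable_pt_lim_cosh].
  - intros t ht.
    enough (0 <= sinh t) by nra.
    rewrite <- sinh_0; destruct (Req_dec t 0) as [-> | hne]; [lra | ].
    left; apply sinh_lt; lra.
Qed.

Lemma cosh_pos (x : R) : 0 < cosh x.
Proof.
  unfold cosh; generalize (exp_pos x) (exp_pos (- x)); lra.
Qed.

Lemma cosh_ge_1 (x : R) : 1 <= cosh x.
Proof.
  unfold cosh; generalize (exp_ineq1_le x) (exp_ineq1_le (- x)); lra.
Qed.

Lemma cosh_even (x : R) : cosh (- x) = cosh x.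
Proof. unfold cosh; rewrite Ropp_involutive; field. Qed.

(** For x >= 0 both sides vanish at 0 and their derivatives are tanh and the identity; evenness
    covers x < 0. *)
Lemma ln_cosh_le (x : R) : ln (cosh x) <= x ^ 2 / 2.
Proof.
  assert (main : forall t, 0 <= t -> ln (cosh t) <= t ^ 2 / 2).
  { intros t ht.
    apply (le_of_derive_le (fun t => ln (cosh t)) (fun t => t ^ 2 / 2)
             (fun t => sinh t * / cosh t) (fun t => t) 0 t ht).
    - rewrite cosh_0, ln_1; lra.
    - intros u _.
      apply (is_derive_comp ln cosh).
      + apply is_derive_Reals, derivable_pt_lim_ln, cosh_pos.
      + apply is_derive_Reals, derivable_pt_lim_cosh.
    - intros u _; auto_derive; [easy | field].
    - intros u hu.
      generalize (sinh_le_mul_cosh u ltac:(lra)) (cosh_pos u); intros h1 h2.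
      apply Rmult_le_reg_r with (cosh u); [exact h2 | ].
      rewrite Rmult_assoc, Rinv_l; lra. }
  destruct (Rle_dec 0 x) as [hx | hx]; [now apply main | ].
  rewrite <- cosh_even; replace (x ^ 2) with ((- x) ^ 2) by ring.
  apply main; lra.
Qed.

(** With t = exp x, t^q = exp x * exp ((q - 1) x) >= exp x * (1 + (q - 1) x), and exp (- x) >= 1 - x
    gives x exp x >= exp x - 1. *)
Lemma Rpower_bernoulli (t q : R) :
  0 < t -> 1 <= q -> 1 + q * (t - 1) <= Rpower t q.
Proof.
  intros ht hq; unfold Rpower.
  set (x := ln t).
  assert (E : t = exp x) by (unfold x; now rewrite exp_ln).
  rewrite E.
  replace (q * x) with (x + (q - 1) * x) by ring.
  rewrite exp_plus.
  generalize (exp_ineq1_le ((q - 1) * x)) (exp_ineq1_le (- x)) (exp_pos x);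
    intros h1 h2 h3.
  assert (h4 : exp x * exp (- x) = 1)
    by (rewrite <- exp_plus, Rplus_opp_r; apply exp_0).
  assert (h5 : 0 <= (q - 1) * (exp x * (exp (- x) - (1 - x)))).
  { apply Rmult_le_pos; [lra | ]. apply Rmult_le_pos; lra. }
  rewrite (Rmult_minus_distr_l (exp x)), h4 in h5.
  assert (h6 := Rmult_le_compat_l (exp x) _ _ (Rlt_le _ _ h3) h1).
  nra.
Qed.

(** After scaling by the midpoint [m], the numbers u/m and v/m sum to 2, so the linear terms of the
    two Bernoulli bounds cancel. *)
Lemma Rpower_midpoint_convex (u v q : R) :
  0 < u -> 0 < v -> 1 <= q ->
  Rpower ((u + v) / 2) q <= (Rpower u q + Rpower v q) / 2.
Proof.
  intros hu hv hq.
  set (m := (u + v) / 2).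
  assert (hm : 0 < m) by (unfold m; lra).
  assert (E : forall w, 0 < w -> Rpower w q = Rpower m q * Rpower (w / m) q).
  { intros w hw.
    rewrite Rpower_mult_distr; [ | lra | now apply Rdiv_lt_0_compat].
    f_equal; field; lra. }
  rewrite (E u hu), (E v hv).
  assert (hP : 0 < Rpower m q) by apply exp_pos.
  generalize (Rpower_bernoulli (u / m) q (Rdiv_lt_0_compat _ _ hu hm) hq)
    (Rpower_bernoulli (v / m) q (Rdiv_lt_0_compat _ _ hv hm) hq); intros h1 h2.
  assert (h3 : u / m + v / m = 2) by (unfold m; field; lra).
  assert (h4 : 2 <= Rpower (u / m) q + Rpower (v / m) q) by nra.
  nra.
Qed.

(** * Power means *)

Lemma power_mean_monotone (r s a b : R) :
  0 < r -> r <= s -> 0 < a -> 0 < b ->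
  power_mean r a b <= power_mean s a b.
Proof.
  intros hr hrs ha hb; unfold power_mean.
  destruct (Req_EM_T r 0) as [e | _]; [lra | ].
  destruct (Req_EM_T s 0) as [e | _]; [lra | ].
  assert (hq : 1 <= s / r) by (apply Rle_div_r; lra).
  generalize (Rpower_midpoint_convex (Rpower a r) (Rpower b r) (s / r)
    (exp_pos _) (exp_pos _) hq).
  rewrite !Rpower_mult; replace (r * (s / r)) with s by (field; lra).
  intros h.
  replace (1 / r) with (s / r * (1 / s)) by (field; lra).
  rewrite <- Rpower_mult.
  apply Rle_Rpower_l.
  - apply Rlt_le, Rdiv_lt_0_compat; lra.
  - split; [apply exp_pos | exact h].
Qed.

Lemma power_mean_sym (r a b : R) : power_mean r a b = power_mean r b a.
Proof.
  unfold power_mean; rewrite (Rmult_comm a b), (Rplus_comm (Rpower a r)).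
  reflexivity.
Qed.

Lemma power_mean_pos (r a b : R) : 0 < a -> 0 < b -> 0 < power_mean r a b.
Proof.
  intros ha hb; unfold power_mean; destruct (Req_EM_T r 0).
  - apply sqrt_lt_R0; nra.
  - apply exp_pos.
Qed.

(** In logarithmic coordinates the mean depends on p only through ln (cosh (p s)) / p, which makes
    its second-order behaviour in s explicit. *)
Lemma power_mean_exp (p m s : R) :
  p <> 0 ->
  power_mean p (exp (m + s)) (exp (m - s)) = exp (m + ln (cosh (p * s)) / p).
Proof.
  intros hp; unfold power_mean.
  destruct (Req_EM_T p 0) as [e | _]; [lra | ].
  unfold Rpower; rewrite !ln_exp.
  replace ((exp (p * (m + s)) + exp (p * (m - s))) / 2)
    with (exp (p * m) * cosh (p * s)).
  - rewrite ln_mult, ln_exp; [ | apply exp_pos | apply cosh_pos].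
    f_equal; field; lra.
  - unfold cosh.
    replace (p * (m + s)) with (p * m + p * s) by ring.
    replace (p * (m - s)) with (p * m + - (p * s)) by ring.
    rewrite !exp_plus; field.
Qed.

(** The term ln (cosh (p s)) / p is nonpositive for p < 0 and at most p s^2 / 2 for p > 0, while p =
    0 gives exp m. A positive [q] above p yields one bound for all three cases. *)
Lemma power_mean_le_exp (p q m s : R) :
  p <= q -> 0 < q ->
  power_mean p (exp (m + s)) (exp (m - s)) <= exp (m + q * s ^ 2 / 2).
Proof.
  intros hpq hq.
  assert (hs : 0 <= s ^ 2) by nra.
  assert (mono : forall u v, u <= v -> exp u <= exp v).
  { intros u v [h | ->]; [left; now apply exp_increasing | apply Rle_refl]. }
  destruct (Rtotal_order p 0) as [hp | [-> | hp]].
  - rewrite power_mean_exp by lra; apply mono.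
    assert (h : 0 <= ln (cosh (p * s))).
    { rewrite <- ln_1; apply ln_le; [lra | apply cosh_ge_1]. }
    assert (h' : ln (cosh (p * s)) / p <= 0); [ | nra].
    assert (hi : / p < 0) by now apply Rinv_lt_0_compat.
    unfold Rdiv; nra.
  - unfold power_mean; destruct (Req_EM_T 0 0) as [_ | n]; [ | lra].
    rewrite <- exp_plus.
    replace (m + s + (m - s)) with (m + m) by ring.
    rewrite exp_plus, sqrt_square; [apply mono; nra | left; apply exp_pos].
  - rewrite power_mean_exp by lra; apply mono.
    assert (h := ln_cosh_le (p * s)).
    assert (h' : ln (cosh (p * s)) / p <= p * s ^ 2 / 2).
    { apply Rle_div_l; [lra | ].
      replace (p * s ^ 2 / 2 * p) with ((p * s) ^ 2 / 2) by field; exact h. }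
    nra.
Qed.

(** * Failure of the bound for exponents below 4/3 *)

(** The Taylor coefficient of arcsinh at order three is -1/6, so any k < 1/6 is admissible for small
    t. The proof compares derivatives. *)
Lemma arcsinh_le_cubic (k t : R) :
  0 <= k -> 6 * k <= 1 -> 0 <= t -> 6 * k * t ^ 2 <= 1 - 6 * k ->
  arcsinh t <= t - k * t ^ 3.
Proof.
  intros hk hk' ht h.
  apply (le_of_derive_le arcsinh (fun t => t - k * t ^ 3)
           (fun t => / sqrt (t ^ 2 + 1)) (fun t => 1 - 3 * k * t ^ 2) 0 t ht).
  - rewrite arcsinh_0; lra.
  - intros u _; apply is_derive_arcsinh.
  - intros u _; auto_derive; [easy | ring].
  - intros u hu.
    assert (hu2 : u ^ 2 <= t ^ 2) by nra.
    assert (hu0 : 0 <= u ^ 2) by nra.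
    set (z := u ^ 2) in *.
    assert (hz : 6 * k * z <= 1 - 6 * k) by nra.
    assert (hr : 0 < sqrt (z + 1)) by (apply sqrt_lt_R0; lra).
    apply Rmult_le_reg_r with (sqrt (z + 1)); [exact hr | ].
    rewrite Rinv_l by lra.
    assert (hkz : 0 <= k * z) by nra.
    assert (hpos : 0 <= 1 - 3 * k * z) by nra.
    (* With z = u^2, the claim is 1 <= (1 - 3kz)^2 (1 + z), and the right side equals 1 + z (1 - 6k
       - 6kz) + (3kz)^2 (1 + z). *)
    assert (h1 : 0 <= z * (1 - 6 * k - 6 * k * z)) by (apply Rmult_le_pos; lra).
    assert (h2 : 0 <= (3 * k * z) ^ 2 * (z + 1)) by (apply Rmult_le_pos; nra).
    assert (h3 : sqrt 1 <= sqrt ((1 - 3 * k * z) ^ 2 * (z + 1)))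
      by (apply sqrt_le_1_alt; nra).
    rewrite sqrt_1, sqrt_mult, sqrt_pow2 in h3 by nra.
    exact h3.
Qed.

Lemma neuman_sandor_mean_around_1 (t : R) :
  0 < t -> neuman_sandor_mean (1 + t) (1 - t) = t / arcsinh t.
Proof.
  intros ht; unfold neuman_sandor_mean.
  assert (0 < arcsinh t) by (rewrite <- arcsinh_0; now apply arcsinh_lt).
  replace ((1 + t - (1 - t)) / (1 + t + (1 - t))) with t by (field; lra).
  field; lra.
Qed.

(** Here arcsinh t <= t (1 - k t^2) <= t exp (- k t^2), and the mean is t / arcsinh t. *)
Lemma exp_le_neuman_sandor_mean (k t : R) :
  0 <= k -> 6 * k <= 1 -> 0 < t < 1 -> 6 * k * t ^ 2 <= 1 - 6 * k ->
  exp (k * t ^ 2) <= neuman_sandor_mean (1 + t) (1 - t).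
Proof.
  intros hk hk' ht h.
  rewrite neuman_sandor_mean_around_1 by lra.
  assert (hf : 0 < arcsinh t) by (rewrite <- arcsinh_0; now apply arcsinh_lt).
  apply Rle_div_r; [exact hf | ].
  assert (h1 := arcsinh_le_cubic k t hk hk' (Rlt_le _ _ (proj1 ht)) h).
  assert (h2 := exp_ineq1_le (- (k * t ^ 2))).
  assert (h3 : exp (k * t ^ 2) * exp (- (k * t ^ 2)) = 1)
    by (rewrite <- exp_plus, Rplus_opp_r; apply exp_0).
  assert (h4 := exp_pos (k * t ^ 2)).
  apply Rle_trans with (exp (k * t ^ 2) * (t * exp (- (k * t ^ 2)))).
  - apply Rmult_le_compat_l; [lra | ]. nra.
  - rewrite (Rmult_comm t), <- Rmult_assoc, h3; lra.
Qed.

(* With [1 + t = exp (m + s)] and [1 - t = exp (m - s)], one has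
   [m = ln (1 - t^2) / 2 <= - t^2 / 2] and [0 <= s <= t / (1 - t)]. *)
Lemma power_mean_around_1_le (p q t : R) :
  p <= q -> 0 < q -> 0 < t < 1 ->
  power_mean p (1 + t) (1 - t)
    <= exp ((q / (1 - t) ^ 2 - 1) * t ^ 2 / 2).
Proof.
  intros hpq hq ht.
  set (x := ln (1 + t)); set (y := ln (1 - t)).
  set (m := (x + y) / 2); set (s := (x - y) / 2).
  assert (Ex : exp (m + s) = 1 + t).
  { replace (m + s) with x by (unfold m, s; field); apply exp_ln; lra. }
  assert (Ey : exp (m - s) = 1 - t).
  { replace (m - s) with y by (unfold m, s; field); apply exp_ln; lra. }
  rewrite <- Ex, <- Ey at 1.
  apply Rle_trans with (1 := power_mean_le_exp p q m s hpq hq).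
  assert (ln_le_sub : forall u, 0 < u -> ln u <= u - 1).
  { intros u hu; assert (h := exp_ineq1_le (ln u)); rewrite exp_ln in h; lra. }
  assert (hm : m <= - t ^ 2 / 2).
  { assert (h := ln_le_sub ((1 + t) * (1 - t)) ltac:(nra)).
    rewrite ln_mult in h by lra; fold x y in h; unfold m; nra. }
  assert (hs0 : 0 <= s).
  { assert (y < x) by (apply ln_increasing; lra); unfold s; lra. }
  assert (hs : s <= t / (1 - t)).
  { assert (h := ln_le_sub ((1 + t) / (1 - t))
      ltac:(apply Rdiv_lt_0_compat; lra)).
    rewrite ln_div in h by lra; fold x y in h.
    replace ((1 + t) / (1 - t) - 1) with (2 * (t / (1 - t))) in h
      by (field; lra).
    unfold s; lra. }
  assert (hs2 : s ^ 2 <= (t / (1 - t)) ^ 2) by (apply pow_incr; lra).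
  replace ((q / (1 - t) ^ 2 - 1) * t ^ 2 / 2)
    with (- t ^ 2 / 2 + q * (t / (1 - t)) ^ 2 / 2) by (field; lra).
  assert (h : m + q * s ^ 2 / 2 <= - t ^ 2 / 2 + q * (t / (1 - t)) ^ 2 / 2)
    by nra.
  destruct h as [h | ->]; [left; now apply exp_increasing | apply Rle_refl].
Qed.

Lemma power_mean_le_neuman_sandor_mean (p : R) :
  p < 4 / 3 ->
  exists a b, 0 < a /\ 0 < b /\ a <> b /\
    power_mean p a b <= neuman_sandor_mean a b.
Proof.
  intros hp.
  (* Raising p to at least 1 makes the exponent positive and bounds the gap to 4/3 by 1/3. *)
  set (q := Rmax p 1).
  assert (hpq : p <= q) by apply Rmax_l.
  assert (hq1 : 1 <= q) by apply Rmax_r.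
  assert (hq2 : q < 4 / 3) by (apply Rmax_lub_lt; lra).
  clearbody q.
  (* As t tends to 0, the coefficients of t^2 in the exponents are (q - 1)/2 = 1/6 - e/2 for the
     power mean bound and 1/6 for N; [k] is halfway between. The choice t = e/8 is small enough for
     (4/3 - e/2) (1 - t)^2 >= 4/3 - e. *)
  set (e := 4 / 3 - q); set (t := e / 8); set (k := 1 / 6 - e / 4).
  assert (he : 0 < e <= 1 / 3) by (unfold e; lra).
  assert (ht : 0 < t < 1) by (unfold t; lra).
  exists (1 + t), (1 - t); repeat split; try lra.
  apply Rle_trans with (1 := power_mean_around_1_le p q t hpq
    ltac:(lra) ht).
  apply Rle_trans with (exp (k * t ^ 2)).
  - assert (h : q / (1 - t) ^ 2 <= 2 * k + 1).
    { apply Rle_div_l; [nra | ].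
      replace q with (4 / 3 - e) by (unfold e; ring).
      unfold k, t; nra. }
    assert (h' : (q / (1 - t) ^ 2 - 1) * t ^ 2 / 2 <= k * t ^ 2).
    { assert (0 < t ^ 2) by nra; nra. }
    destruct h' as [h' | ->]; [left; now apply exp_increasing | apply Rle_refl].
  - apply exp_le_neuman_sandor_mean; [unfold k; lra | unfold k; lra | exact ht | ].
    unfold k, t; nra.
Qed.

(** * The ratio of the Neuman-Sandor mean to the power mean of order 4/3 *)

Definition asinh_part (y : R) : R := arcsinh ((1 - y ^ 3) / (1 + y ^ 3)).

(** Fractional powers are written as exponentials of logarithms, so that products become sums of
    exponents. *)
Definition power_part (y : R) : R :=
  (1 - y ^ 3) * exp (- (ln 2 / 4) - 3 / 4 * ln (1 + y ^ 4)).

(* Logarithm of the quotient [asinh_part' / power_part']. *)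
Definition log_slope (y : R) : R :=
  7 / 4 * ln (1 + y ^ 4) - ln (1 + y ^ 3) - ln (1 + y)
    - / 2 * ln (1 + y ^ 6) + 3 / 4 * ln 2.

Definition power_part' (y : R) : R :=
  - (3 * y ^ 2 * (1 + y) * exp (- (ln 2 / 4) - 7 / 4 * ln (1 + y ^ 4))).

Lemma one_plus_pow_pos (n : nat) (y : R) : 0 <= y -> 0 < 1 + y ^ n.
Proof. intros hy; assert (h := pow_le y n hy); lra. Qed.

(** Over the common factor (1 + y^4)^(-7/4) the product rule gives -3 y^2 (1 + y^4) - 3 y^3 (1 -
    y^3), where the y^6 terms cancel. *)
Lemma is_derive_power_part (y : R) :
  0 <= y -> is_derive power_part y (power_part' y).
Proof.
  intros hy; unfold power_part, power_part'.
  assert (h4 := one_plus_pow_pos 4 y hy).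
  auto_derive; [exact h4 | ].
  replace (y * (y * (y * (y * 1)))) with (y ^ 4) by ring.
  set (u := - (ln 2 / 4) + - (3 / 4 * ln (1 + y ^ 4))).
  replace (- (ln 2 / 4) - 7 / 4 * ln (1 + y ^ 4))
    with (u + - ln (1 + y ^ 4)) by (unfold u; field).
  rewrite exp_plus, exp_Ropp, (exp_ln (1 + y ^ 4) h4).
  field; lra.
Qed.

(** The product form, rather than a quotient of derivatives, stays meaningful at y = 0, where
    [power_part'] vanishes. *)
Lemma is_derive_asinh_part (y : R) :
  0 <= y -> is_derive asinh_part y (exp (log_slope y) * power_part' y).
Proof.
  intros hy; unfold asinh_part.
  assert (h3 := one_plus_pow_pos 3 y hy).
  assert (h4 := one_plus_pow_pos 4 y hy).
  assert (h6 := one_plus_pow_pos 6 y hy).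
  set (z := (1 - y ^ 3) / (1 + y ^ 3)).
  assert (hz : is_derive (fun y => (1 - y ^ 3) / (1 + y ^ 3)) y
                 (- (6 * y ^ 2) / (1 + y ^ 3) ^ 2)).
  { auto_derive; [lra | field; lra]. }
  assert (E : exp (log_slope y) * power_part' y
    = - (6 * y ^ 2) / (1 + y ^ 3) ^ 2 * / sqrt (z ^ 2 + 1)).
  { set (w := exp (/ 2 * ln (1 + y ^ 6))).
    set (v := exp (/ 2 * ln 2)).
    assert (hw : w * w = 1 + y ^ 6).
    { unfold w; rewrite <- exp_plus.
      replace (/ 2 * ln (1 + y ^ 6) + / 2 * ln (1 + y ^ 6))
        with (ln (1 + y ^ 6)) by field.
      now apply exp_ln. }
    assert (hv : v * v = 2).
    { unfold v; rewrite <- exp_plus.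
      replace (/ 2 * ln 2 + / 2 * ln 2) with (ln 2) by field.
      apply exp_ln; lra. }
    assert (hw0 : 0 < w) by apply exp_pos.
    assert (hv0 : 0 < v) by apply exp_pos.
    (* This is 1 + z^2 = 2 (1 + y^6) / (1 + y^3)^2, with [v] and [w] the square roots of 2 and 1 +
       y^6. *)
    assert (Es : sqrt (z ^ 2 + 1) = v * w / (1 + y ^ 3)).
    { apply Rsqr_inj; [apply sqrt_pos | | ].
      - apply Rlt_le, Rdiv_lt_0_compat; nra.
      - rewrite Rsqr_sqrt by nra; unfold Rsqr.
        replace (v * w / (1 + y ^ 3) * (v * w / (1 + y ^ 3)))
          with (v * v * (w * w) / (1 + y ^ 3) ^ 2) by (field; lra).
        rewrite hv, hw; unfold z; field; lra. }
    rewrite Es; unfold power_part', log_slope.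
    rewrite Ropp_mult_distr_r_reverse, <- !Rmult_assoc.
    rewrite (Rmult_comm (exp _)), !Rmult_assoc, (Rmult_comm (exp _)).
    rewrite !Rmult_assoc, <- exp_plus.
    replace (- (ln 2 / 4) - 7 / 4 * ln (1 + y ^ 4)
       + (7 / 4 * ln (1 + y ^ 4) - ln (1 + y ^ 3) - ln (1 + y)
          - / 2 * ln (1 + y ^ 6) + 3 / 4 * ln 2))
      with (/ 2 * ln 2 + - ln (1 + y ^ 3) + - ln (1 + y)
            + - (/ 2 * ln (1 + y ^ 6))) by field.
    rewrite !exp_plus, !exp_Ropp, !exp_ln by lra.
    fold w v.
    replace v with (2 / v) at 1 by (rewrite <- hv; field; lra).
    field; lra. }
  rewrite E.
  apply (is_derive_comp arcsinh (fun y => (1 - y ^ 3) / (1 + y ^ 3)) y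
           (/ sqrt (z ^ 2 + 1)) (- (6 * y ^ 2) / (1 + y ^ 3) ^ 2)).
  - apply is_derive_arcsinh.
  - exact hz.
Qed.

(** Over a common denominator the derivative has numerator -(1 - y)^3 times a polynomial with
    positive coefficients, hence is negative on (0, 1). *)
Lemma log_slope_decreasing (x y : R) :
  0 <= x -> x < y -> y <= 1 -> log_slope y < log_slope x.
Proof.
  intros hx hxy hy.
  destruct (MVT_cor2 log_slope
    (fun y => - ((1 - y) ^ 3 * (1 + 3 * y + 9 * y ^ 2 + 16 * y ^ 3 + 18 * y ^ 4
        + 18 * y ^ 5 + 16 * y ^ 6 + 9 * y ^ 7 + 3 * y ^ 8 + y ^ 9))
      / ((1 + y ^ 4) * (1 + y ^ 3) * (1 + y) * (1 + y ^ 6))) x y hxy)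
    as [c [E hc]].
  - intros t ht; apply is_derive_Reals; unfold log_slope.
    assert (h3 := one_plus_pow_pos 3 t ltac:(lra)).
    assert (h4 := one_plus_pow_pos 4 t ltac:(lra)).
    assert (h6 := one_plus_pow_pos 6 t ltac:(lra)).
    auto_derive; [repeat split; try assumption; lra | ].
    field; repeat split; lra.
  - assert (h3 := one_plus_pow_pos 3 c ltac:(lra)).
    assert (h4 := one_plus_pow_pos 4 c ltac:(lra)).
    assert (h6 := one_plus_pow_pos 6 c ltac:(lra)).
    assert (hP : forall n, 0 < c ^ n) by (intros n; apply pow_lt; lra).
    match type of E with _ = - ?n / ?d * _ =>
      assert (hd : 0 < d) by (repeat apply Rmult_lt_0_compat; lra);
      assert (hn : 0 < n);
      [ | assert (hq := Rdiv_lt_0_compat _ _ hn hd);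
          replace (- n / d) with (- (n / d)) in E by (field; lra); nra ]
    end.
    apply Rmult_lt_0_compat; [apply pow_lt; lra | ].
    generalize (hP 2%nat) (hP 3%nat) (hP 4%nat) (hP 5%nat) (hP 6%nat)
      (hP 7%nat) (hP 8%nat) (hP 9%nat); lra.
Qed.

Lemma log_slope_1 : log_slope 1 = 0.
Proof.
  unfold log_slope; rewrite !pow1.
  replace (1 + 1) with 2 by ring; field.
Qed.

Lemma parts_mean_value (x y : R) :
  0 <= x -> x < y ->
  exists c, x < c < y /\
    asinh_part x - asinh_part y
      = exp (log_slope c) * (power_part x - power_part y).
Proof.
  intros hx hxy.
  destruct (cauchy_mean_value asinh_part power_part
    (fun y => exp (log_slope y) * power_part' y) power_part' x y hxy)
    as [c [hc E]].
  - intros t ht; apply is_derive_asinh_part; lra.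
  - intros t ht; apply is_derive_power_part; lra.
  - exists c; split; [exact hc | ].
    (* The point c is interior, so c > 0 even when x = 0, and the factor y^2 of [power_part'] does
       not vanish there. *)
    assert (hG : power_part' c <> 0).
    { unfold power_part'; apply Ropp_neq_0_compat, Rgt_not_eq.
      repeat apply Rmult_lt_0_compat; try lra; apply exp_pos. }
    apply Rmult_eq_reg_r with (power_part' c); [nra | exact hG].
Qed.

Lemma power_part_pos (y : R) : 0 <= y < 1 -> 0 < power_part y.
Proof.
  intros hy; apply Rmult_lt_0_compat; [ | apply exp_pos].
  assert (h : y ^ 3 < 1) by nra.
  lra.
Qed.

Lemma asinh_part_1 : asinh_part 1 = 0.
Proof.
  unfold asinh_part; replace ((1 - 1 ^ 3) / (1 + 1 ^ 3)) with 0 by field.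
  apply arcsinh_0.
Qed.

Lemma power_part_1 : power_part 1 = 0.
Proof. unfold power_part; ring. Qed.

Lemma power_part_decreasing (x y : R) :
  0 <= x -> x < y -> power_part y < power_part x.
Proof.
  intros hx hxy.
  destruct (MVT_cor2 power_part power_part' x y hxy) as [c [E hc]].
  - intros t ht; apply is_derive_Reals, is_derive_power_part; lra.
  - assert (h : power_part' c < 0); [ | nra].
    apply Ropp_lt_gt_0_contravar.
    repeat apply Rmult_lt_0_compat; try lra; apply exp_pos.
Qed.

Lemma asinh_part_eq (y : R) :
  0 <= y < 1 ->
  exists c, y < c < 1 /\ asinh_part y = exp (log_slope c) * power_part y.
Proof.
  intros hy.
  destruct (parts_mean_value y 1) as [c [hc E]]; [lra | lra | ].
  rewrite asinh_part_1, power_part_1, !Rminus_0_r in E.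
  now exists c.
Qed.

(** The chord from y to 1 has slope [exp (log_slope c)] with c < 1, which exceeds the slope 1 at the
    endpoint. This becomes the upper bound on N. *)
Lemma power_part_lt_asinh_part (y : R) :
  0 <= y < 1 -> power_part y < asinh_part y.
Proof.
  intros hy; destruct (asinh_part_eq y hy) as [c [hc ->]].
  assert (h : 1 < exp (log_slope c)).
  { rewrite <- exp_0, <- log_slope_1.
    apply exp_increasing, log_slope_decreasing; lra. }
  assert (h' := power_part_pos y hy); nra.
Qed.

(* The slopes of the curve [(power_part, asinh_part)] over [[0, y]] and
   [[y, 1]] are [exp (log_slope d)] and [exp (log_slope c)] with [d < y < c]. *)
Lemma asinh_part_mul_lt (y : R) :
  0 < y < 1 -> asinh_part y * power_part 0 < asinh_part 0 * power_part y.
Proof.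
  intros hy; destruct (asinh_part_eq y) as [c [hc Ec]]; [lra | ].
  destruct (parts_mean_value 0 y) as [d [hd Ed]]; [lra | lra | ].
  assert (h : exp (log_slope c) < exp (log_slope d))
    by (apply exp_increasing, log_slope_decreasing; lra).
  assert (hG := power_part_decreasing 0 y ltac:(lra) ltac:(lra)).
  assert (hG' := power_part_pos y ltac:(lra)).
  assert (E0 : asinh_part 0 = exp (log_slope c) * power_part y
    + exp (log_slope d) * (power_part 0 - power_part y)) by lra.
  rewrite Ec, E0.
  assert (exp (log_slope c) * (power_part 0 - power_part y)
    < exp (log_slope d) * (power_part 0 - power_part y))
    by (apply Rmult_lt_compat_r; lra).
  replace (exp (log_slope c) * power_part y * power_part 0) with
   (power_part y * (exp (log_slope c) * power_part 0)) by ring.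
  rewrite (Rmult_comm _ (power_part y)).
  apply Rmult_lt_compat_l; lra.
Qed.

(** * Transfer to the means *)

Lemma neuman_sandor_mean_sym (a b : R) :
  0 < a -> 0 < b -> neuman_sandor_mean a b = neuman_sandor_mean b a.
Proof.
  intros ha hb; unfold neuman_sandor_mean.
  replace ((b - a) / (b + a)) with (- ((a - b) / (a + b))) by (field; lra).
  rewrite arcsinh_opp; unfold Rdiv.
  rewrite Ropp_mult_distr_r_reverse, Rinv_opp; ring.
Qed.

(** Both sides equal a (1 - y^3) / 2. Taking b = a y^3 turns b^(4/3) into a^(4/3) y^4. *)
Lemma neuman_sandor_mean_parts (a y : R) :
  0 < a -> 0 < y < 1 ->
  neuman_sandor_mean a (a * y ^ 3) * asinh_part y
    = power_mean (4 / 3) a (a * y ^ 3) * power_part y.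
Proof.
  intros ha hy.
  assert (h3 := one_plus_pow_pos 3 y ltac:(lra)).
  assert (h4 := one_plus_pow_pos 4 y ltac:(lra)).
  assert (hy3 : 0 < y ^ 3) by (apply pow_lt; lra).
  assert (hf : asinh_part y <> 0).
  { assert (h1 := power_part_lt_asinh_part y ltac:(lra)).
    assert (h2 := power_part_pos y ltac:(lra)); lra. }
  assert (EN : neuman_sandor_mean a (a * y ^ 3) * asinh_part y
    = a * (1 - y ^ 3) / 2).
  { unfold neuman_sandor_mean.
    replace ((a - a * y ^ 3) / (a + a * y ^ 3))
      with ((1 - y ^ 3) / (1 + y ^ 3)) by (field; split; nra).
    fold (asinh_part y); field; exact hf. }
  assert (EA : power_mean (4 / 3) a (a * y ^ 3)
    = a * exp (3 / 4 * (ln (1 + y ^ 4) - ln 2))).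
  { unfold power_mean; destruct (Req_EM_T (4 / 3) 0) as [e | _]; [lra | ].
    rewrite <- Rpower_mult_distr by nra.
    replace (Rpower (y ^ 3) (4 / 3)) with (y ^ 4).
    2:{ rewrite <- (Rpower_pow 3), Rpower_mult, <- (Rpower_pow 4) by lra.
        f_equal; simpl; field. }
    replace ((Rpower a (4 / 3) + Rpower a (4 / 3) * y ^ 4) / 2)
      with (Rpower a (4 / 3) * ((1 + y ^ 4) / 2)) by field.
    rewrite <- Rpower_mult_distr; [ | apply exp_pos | lra].
    rewrite Rpower_mult.
    replace (4 / 3 * (1 / (4 / 3))) with 1 by field.
    rewrite Rpower_1 by exact ha.
    unfold Rpower at 1; rewrite ln_div by lra.
    do 2 f_equal; field. }
  rewrite EN, EA; unfold power_part.
  replace (a * exp (3 / 4 * (ln (1 + y ^ 4) - ln 2)) *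
     ((1 - y ^ 3) * exp (- (ln 2 / 4) - 3 / 4 * ln (1 + y ^ 4))))
    with (a * (1 - y ^ 3) * (exp (3 / 4 * (ln (1 + y ^ 4) - ln 2))
       * exp (- (ln 2 / 4) - 3 / 4 * ln (1 + y ^ 4)))) by ring.
  rewrite <- exp_plus.
  replace (3 / 4 * (ln (1 + y ^ 4) - ln 2)
     + (- (ln 2 / 4) - 3 / 4 * ln (1 + y ^ 4))) with (- ln 2) by field.
  rewrite exp_Ropp, exp_ln by lra; reflexivity.
Qed.

(** The value y = 0 is the limit b/a -> 0, where arcsinh 1 = ln (1 + sqrt 2). *)
Lemma alpha1_parts : alpha1 = power_part 0 / asinh_part 0.
Proof.
  unfold alpha1, power_part, asinh_part, arcsinh, Rpower.
  replace ((1 - 0 ^ 3) / (1 + 0 ^ 3)) with 1 by field.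
  replace (1 ^ 2 + 1) with 2 by ring.
  replace (1 + 0 ^ 4) with 1 by ring.
  replace (1 - 0 ^ 3) with 1 by ring.
  rewrite ln_1, (Rplus_comm 1).
  replace (- (ln 2 / 4) - 3 / 4 * 0) with (- (1 / 4 * ln 2)) by field.
  rewrite exp_Ropp; unfold Rdiv; rewrite Rinv_mult; ring.
Qed.

Lemma two_sided_bound_scaled (a y : R) :
  0 < a -> 0 < y < 1 ->
  alpha1 * power_mean (4 / 3) a (a * y ^ 3) < neuman_sandor_mean a (a * y ^ 3)
    < power_mean (4 / 3) a (a * y ^ 3).
Proof.
  intros ha hy.
  assert (E := neuman_sandor_mean_parts a y ha hy).
  assert (hA : 0 < power_mean (4 / 3) a (a * y ^ 3)).
  { apply power_mean_pos; [exact ha | ].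
    apply Rmult_lt_0_compat; [exact ha | apply pow_lt; lra]. }
  assert (hG := power_part_pos y ltac:(lra)).
  assert (hGf := power_part_lt_asinh_part y ltac:(lra)).
  assert (hG0 := power_part_pos 0 ltac:(lra)).
  assert (hGf0 := power_part_lt_asinh_part 0 ltac:(lra)).
  assert (hlt := asinh_part_mul_lt y hy).
  revert E hA; generalize (power_mean (4 / 3) a (a * y ^ 3))
    (neuman_sandor_mean a (a * y ^ 3)); intros A N E hA.
  (* After multiplication by the positive [asinh_part y], the upper bound reads G < f; the lower
     one, multiplied also by [asinh_part 0], becomes [asinh_part_mul_lt]. *)
  split; apply Rmult_lt_reg_r with (asinh_part y); try lra; rewrite E; [ | nra].
  apply Rmult_lt_reg_r with (asinh_part 0); [lra | ].
  rewrite alpha1_parts.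
  replace (power_part 0 / asinh_part 0 * A * asinh_part y * asinh_part 0)
    with (A * (asinh_part y * power_part 0)) by (field; lra).
  rewrite Rmult_assoc, (Rmult_comm (power_part y)).
  now apply Rmult_lt_compat_l.
Qed.

Lemma cube_ratio (a b : R) :
  0 < b -> b < a -> exists y, 0 < y < 1 /\ b = a * y ^ 3.
Proof.
  intros hb hba.
  assert (hr : 0 < b / a) by (apply Rdiv_lt_0_compat; lra).
  exists (Rpower (b / a) (1 / 3)); split; [split; [apply exp_pos | ] | ].
  - apply Rlt_le_trans with (exp 0); [apply exp_increasing | rewrite exp_0; lra].
    assert (ln (b / a) < 0); [ | lra].
    rewrite <- ln_1; apply ln_increasing; [exact hr | ].
    apply Rlt_div_l; lra.
  - rewrite <- Rpower_pow, Rpower_mult by apply exp_pos.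
    replace (1 / 3 * INR 3) with 1 by (simpl; field).
    rewrite Rpower_1 by exact hr; field; lra.
Qed.

Lemma two_sided_bound (a b : R) :
  0 < a -> 0 < b -> a <> b ->
  alpha1 * power_mean (4 / 3) a b < neuman_sandor_mean a b
    < power_mean (4 / 3) a b.
Proof.
  assert (main : forall a b, 0 < b -> b < a ->
    alpha1 * power_mean (4 / 3) a b < neuman_sandor_mean a b
      < power_mean (4 / 3) a b).
  { clear a b; intros a b hb hba.
    destruct (cube_ratio a b hb hba) as [y [hy ->]].
    apply two_sided_bound_scaled; lra. }
  intros ha hb hne.
  destruct (Rtotal_order a b) as [h | [h | h]]; [ | contradiction | now apply main].
  rewrite neuman_sandor_mean_sym, power_mean_sym by assumption.
  now apply main.
Qed.

(** * Sharpness of the constants *)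

(** Continuity, drawn from differentiability, carries a strict inequality from an endpoint y = 0 or
    y = 1 to admissible y in (0, 1). *)
Lemma is_derive_pos_nearby (f : R -> R) (x l : R) :
  is_derive f x l -> 0 < f x ->
  exists d, 0 < d /\ forall z, Rabs (z - x) < d -> 0 < f z.
Proof.
  intros hf hx.
  assert (hc : continuous f x) by
    (apply (ex_derive_continuous (V := R_NormedModule)); now exists l).
  destruct (hc (fun z => 0 < z) (open_gt 0 (f x) hx)) as [d hd].
  exists d; split; [apply cond_pos | intros z hz; now apply hd].
Qed.

(** If c > [alpha1], then c f(0) > G(0), which persists for small y > 0; the pair (1, y^3) then
    violates the assumed bound. *)
Lemma lower_constant_sharp (c : R) :
  (forall a b, 0 < a -> 0 < b -> a <> b ->
     c * power_mean (4 / 3) a b < neuman_sandor_mean a b) ->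
  c <= alpha1.
Proof.
  intros hc; apply Rnot_lt_le; intros hlt.
  assert (hG0 := power_part_pos 0 ltac:(lra)).
  assert (hGf0 := power_part_lt_asinh_part 0 ltac:(lra)).
  destruct (is_derive_pos_nearby (fun y => c * asinh_part y - power_part y) 0
    (c * (exp (log_slope 0) * power_part' 0) - power_part' 0)) as [d [hd h]].
  - apply (is_derive_minus (fun y => c * asinh_part y) power_part).
    + apply is_derive_scal, is_derive_asinh_part; lra.
    + apply is_derive_power_part; lra.
  - rewrite alpha1_parts in hlt.
    apply Rlt_div_l in hlt; lra.
  - set (y := Rmin (d / 2) (1 / 2)).
    assert (hy : 0 < y < 1).
    { unfold y; generalize (Rmin_r (d / 2) (1 / 2)); split; [ | lra].
      apply Rmin_glb_lt; lra. }
    assert (hyd : y <= d / 2) by apply Rmin_l.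
    specialize (h y); rewrite Rminus_0_r, Rabs_pos_eq in h by lra.
    specialize (h ltac:(lra)).
    assert (hy3 : 0 < y ^ 3) by (apply pow_lt; lra).
    assert (hy3' : y ^ 3 < 1) by nra.
    specialize (hc 1 (1 * y ^ 3) ltac:(lra) ltac:(lra) ltac:(lra)).
    assert (E := neuman_sandor_mean_parts 1 y ltac:(lra) hy).
    assert (hA := power_mean_pos (4 / 3) 1 (1 * y ^ 3) ltac:(lra) ltac:(lra)).
    assert (hG := power_part_pos y ltac:(lra)).
    assert (hGf := power_part_lt_asinh_part y ltac:(lra)).
    nra.
Qed.

(** At y = 1 both parts vanish, so the argument passes to slopes: the assumed bound gives 1 < c exp
    (log_slope d) for some d in (y, 1), hence 1 < c exp (log_slope y) on all of (0, 1). For c < 1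
    this fails near y = 1, where the slope tends to 1. *)
Lemma upper_constant_sharp (c : R) :
  (forall a b, 0 < a -> 0 < b -> a <> b ->
     neuman_sandor_mean a b < c * power_mean (4 / 3) a b) ->
  1 <= c.
Proof.
  intros hc; apply Rnot_lt_le; intros hlt.
  assert (hcy : forall y, 0 < y < 1 -> 1 < c * exp (log_slope y)).
  { intros y hy.
    assert (hy3 : 0 < y ^ 3) by (apply pow_lt; lra).
    assert (hy3' : y ^ 3 < 1) by nra.
    specialize (hc 1 (1 * y ^ 3) ltac:(lra) ltac:(lra) ltac:(lra)).
    assert (E := neuman_sandor_mean_parts 1 y ltac:(lra) hy).
    assert (hA := power_mean_pos (4 / 3) 1 (1 * y ^ 3) ltac:(lra) ltac:(lra)).
    assert (hG := power_part_pos y ltac:(lra)).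
    assert (hGf := power_part_lt_asinh_part y ltac:(lra)).
    assert (h : power_part y < c * asinh_part y).
    { apply Rmult_lt_reg_l with (1 := hA); rewrite <- E.
      replace (power_mean (4 / 3) 1 (1 * y ^ 3) * (c * asinh_part y))
        with (c * power_mean (4 / 3) 1 (1 * y ^ 3) * asinh_part y) by ring.
      apply Rmult_lt_compat_r; lra. }
    assert (hc0 : 0 < c) by nra.
    destruct (asinh_part_eq y) as [d [hd Ed]]; [lra | ].
    rewrite Ed in h.
    assert (h1 : 1 < c * exp (log_slope d)) by nra.
    assert (h2 : exp (log_slope d) < exp (log_slope y))
      by (apply exp_increasing, log_slope_decreasing; lra).
    nra. }
  destruct (is_derive_pos_nearby (fun y => 1 - c * exp (log_slope y)) 1
    (Derive (fun y => 1 - c * exp (log_slope y)) 1)) as [d [hd h]].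
  - apply Derive_correct; unfold log_slope; auto_derive; repeat split; lra.
  - rewrite log_slope_1, exp_0; lra.
  - set (y := Rmax (1 - d / 2) (1 / 2)).
    assert (hy : 0 < y < 1).
    { unfold y; generalize (Rmax_r (1 - d / 2) (1 / 2)); split; [lra | ].
      apply Rmax_lub_lt; lra. }
    assert (hyd : 1 - d / 2 <= y) by apply Rmax_l.
    specialize (h y); specialize (hcy y hy).
    rewrite Rabs_left in h by lra.
    specialize (h ltac:(lra)); lra.
Qed.

(** * Numerical value of the lower constant *)

(* Partial sum of the series of [ln ((1 + u) / (1 - u))]. *)
Definition atanh_poly (u : R) : R :=
  2 * (u + u ^ 3 / 3 + u ^ 5 / 5 + u ^ 7 / 7 + u ^ 9 / 9 + u ^ 11 / 11
       + u ^ 13 / 13).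

Definition atanh_poly' (u : R) : R :=
  2 * (1 + u ^ 2 + u ^ 4 + u ^ 6 + u ^ 8 + u ^ 10 + u ^ 12).

(** The logarithm has derivative 2 / (1 - x^2), and [atanh_poly'] falls short of it by 2 x^14 / (1 -
    x^2). Since x^2 <= 1/4, this lies between 0 and 3 x^14, whose integral is u^15 / 5. *)
Lemma ln_ratio_bounds (u : R) :
  0 <= u <= 1 / 2 ->
  atanh_poly u <= ln ((1 + u) / (1 - u)) <= atanh_poly u + u ^ 15 / 5.
Proof.
  intros hu; rewrite ln_div by lra.
  assert (hd : forall x, 0 <= x <= u ->
    is_derive (fun x => ln (1 + x) - ln (1 - x)) x (2 / (1 - x ^ 2))).
  { intros x hx; auto_derive; [lra | ].
    field; nra. }
  assert (h0 : ln (1 + 0) - ln (1 - 0) = 0)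
    by (rewrite Rplus_0_r, Rminus_0_r; ring).
  split.
  - apply (le_of_derive_le atanh_poly (fun x => ln (1 + x) - ln (1 - x))
             atanh_poly' (fun x => 2 / (1 - x ^ 2)) 0 u); try easy.
    + rewrite h0; unfold atanh_poly; lra.
    + intros x _; unfold atanh_poly, atanh_poly'; auto_derive; [easy | field].
    + intros x hx.
      assert (hx2 : x ^ 2 <= 1 / 4) by nra.
      apply -> Rle_div_r; [ | lra].
      replace (atanh_poly' x * (1 - x ^ 2)) with (2 - 2 * x ^ 14)
        by (unfold atanh_poly'; ring).
      assert (h := pow_le x 14 ltac:(lra)); lra.
  - apply (le_of_derive_le (fun x => ln (1 + x) - ln (1 - x))
             (fun x => atanh_poly x + x ^ 15 / 5)
             (fun x => 2 / (1 - x ^ 2)) (fun x => atanh_poly' x + 3 * x ^ 14)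
             0 u); try easy.
    + rewrite h0; unfold atanh_poly; lra.
    + intros x _; unfold atanh_poly, atanh_poly'; auto_derive; [easy | field].
    + intros x hx.
      assert (hx2 : x ^ 2 <= 1 / 4) by nra.
      apply <- Rle_div_l; [ | lra].
      replace ((atanh_poly' x + 3 * x ^ 14) * (1 - x ^ 2))
        with (2 + x ^ 14 * (1 - 3 * x ^ 2)) by (unfold atanh_poly'; ring).
      assert (h := pow_le x 14 ltac:(lra)).
      assert (h' : 0 <= x ^ 14 * (1 - 3 * x ^ 2))
        by (apply Rmult_le_pos; lra).
      lra.
Qed.

Lemma sqrt2_bounds : 1.4142135 < sqrt 2 < 1.4142136.
Proof.
  assert (h := sqrt_sqrt 2 ltac:(lra)).
  assert (h0 := sqrt_pos 2).
  split; nra.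
Qed.

Lemma ln_sqrt2_plus_1_bounds : 0.881372 < ln (sqrt 2 + 1) < 0.881375.
Proof.
  assert (h := sqrt2_bounds).
  split.
  (* The ratio (1 + u) / (1 - u) equals sqrt 2 + 1 exactly at u = sqrt 2 - 1; the decimals bracket
     this u. *)
  - apply Rlt_le_trans with (ln ((1 + 0.4142135) / (1 - 0.4142135))).
    + eapply Rlt_le_trans; [ | apply ln_ratio_bounds; lra].
      unfold atanh_poly; lra.
    + apply ln_le; lra.
  - apply Rle_lt_trans with (ln ((1 + 0.4142136) / (1 - 0.4142136))).
    + apply ln_le; lra.
    + eapply Rle_lt_trans; [apply ln_ratio_bounds; lra | ].
      unfold atanh_poly; lra.
Qed.

Lemma fourth_root_2_bounds : 1.189207 < Rpower 2 (1 / 4) < 1.189208.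
Proof.
  assert (E : Rpower 2 (1 / 4) ^ 4 = 2).
  { rewrite <- Rpower_pow, Rpower_mult by apply exp_pos.
    replace (1 / 4 * INR 4) with 1 by (simpl; field).
    apply Rpower_1; lra. }
  assert (h0 : 0 < Rpower 2 (1 / 4)) by apply exp_pos.
  split; apply Rnot_le_lt; intros h.
  - assert (h' := pow_incr _ _ 4 (conj (Rlt_le _ _ h0) h)); lra.
  - assert (h' : 1.189208 ^ 4 <= Rpower 2 (1 / 4) ^ 4)
      by (apply pow_incr; lra).
    lra.
Qed.

Lemma alpha1_bounds : 0.95407 <= alpha1 < 0.95408.
Proof.
  unfold alpha1.
  assert (h1 := ln_sqrt2_plus_1_bounds).
  assert (h2 := fourth_root_2_bounds).
  set (q := Rpower 2 (1 / 4)) in *; set (l := ln (sqrt 2 + 1)) in *.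
  assert (hql : 1.189207 * 0.881372 < q * l < 1.189208 * 0.881375)
    by (split; apply Rmult_le_0_lt_compat; lra).
  split; [apply -> Rle_div_r | apply <- Rlt_div_l]; lra.
Qed.

Theorem theorem1 :
  (forall p : R,
     (forall a b : R, 0 < a -> 0 < b -> a <> b ->
        neuman_sandor_mean a b < power_mean p a b) <-> p >= 4 / 3) /\
  (forall a b : R, 0 < a -> 0 < b -> a <> b ->
     alpha1 * power_mean (4 / 3) a b < neuman_sandor_mean a b
       < beta1 * power_mean (4 / 3) a b) /\
  0.95407 <= alpha1 < 0.95408 /\
  (forall c : R,
     (forall a b : R, 0 < a -> 0 < b -> a <> b ->
        c * power_mean (4 / 3) a b < neuman_sandor_mean a b) ->
     c <= alpha1) /\
  (forall c : R,
     (forall a b : R, 0 < a -> 0 < b -> a <> b ->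
        neuman_sandor_mean a b < c * power_mean (4 / 3) a b) ->
     beta1 <= c).
Proof.
  split; [ | split; [ | split; [exact alpha1_bounds | split]]].
  - intros p; split.
    + intros h; apply Rnot_lt_ge; intros hp.
      destruct (power_mean_le_neuman_sandor_mean p hp)
        as [a [b [ha [hb [hab hle]]]]].
      specialize (h a b ha hb hab); lra.
    + intros hp a b ha hb hab.
      apply Rlt_le_trans with (power_mean (4 / 3) a b).
      * now apply two_sided_bound.
      * apply power_mean_monotone; lra.
  - intros a b ha hb hab; unfold beta1; rewrite Rmult_1_l.
    now apply two_sided_bound.
  - exact lower_constant_sharp.
  - exact upper_constant_sharp.
Qed.
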